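(* Fix an integer $\ell\ge3$. Let $X$ be a finite set with $|X|=n$, let $\Omega$ be the set of $\ell$-element subsets of $X$, so $|\Omega|=\binom{n}{\ell}$, let $\Omega_m$ be the set of $m$-element subsets of $\Omega$, so $|\Omega_m|=\binom{|\Omega|}{m}$, and put $\overline m=\min(m,|\Omega|-m)$. If $\overline m,n\to\infty$ in such a way that $$\liminf\;\frac{\overline m}{n^2\ln n}>\frac1{2\ell},$$ then the number $|\Omega_m/S_n^\ell|$ of unlabelled $\ell$-uniform hypergraphs with $n$ vertices and $m$ hyperedges has the asymptotics $$|\Omega_m/S_n^\ell|=\frac{|\Omega_m|}{n!}\,(1+o(1)).$$
   Context: $S_n^\ell$ denotes the image of $\mathrm{Sym}(X)$ in $\mathrm{Sym}(\Omega)$ under its natural action on $\ell$-element subsets of $X$. Elements of $\Omega_m$ are labelled $\ell$-uniform hypergraphs on the vertex set $X$ with $m$ hyperedges; unlabelled hypergraphs are the orbits of $S_n^\ell$ (equivalently of $\mathrm{Sym}(X)$) on $\Omega_m$, and $|\Omega_m/S_n^\ell|$ is the number of these orbits. The statement is along any sequence of pairs $(m,n)$ satisfying the conditions. *)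

(* Defs.v *)
From HB Require Import structures.
From mathcomp Require Import all_boot all_fingroup.

Set Implicit Arguments.
Unset Strict Implicit.
Unset Printing Implicit Defensive.

Local Open Scope group_scope.

Section Hypergraphs.

Variables (X : finType) (l : nat).

(* Omega, the finite type of potential hyperedges *)
Definition hyperedge : Type := {A : {set X} | #|A| == l}.

HB.instance Definition _ := SubFinite.on hyperedge.

(* Omega_m *)
Definition hypergraphs (m : nat) : {set {set hyperedge}} :=
  [set H : {set hyperedge} | #|H| == m].

(* 'P is the natural action of {perm X} on X, 'P^* the one it induces on
   {set X}, and ^? restricts the latter to the subtype hyperedge. A restricted
   action is in general only defined on the stabiliser of the subtype; here
   that is all of {perm X}, by the next two lemmas. *)
Definition hyperedge_act := ('P^*^? : action _ hyperedge)%act.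

Lemma hyperedge_act_dom :
  subact_dom (fun A : {set X} => #|A| == l) ('P^*)%act = [set: {perm X}].
Proof.
apply/setP=> s; rewrite !inE; apply/subsetP=> A.
by rewrite !inE /= /setact card_imset //; apply: perm_inj.
Qed.

Lemma val_hyperedge_act (A : hyperedge) (s : {perm X}) :
  val (hyperedge_act A s) = s @: val A.
Proof. by rewrite val_subact hyperedge_act_dom inE. Qed.

(* S_n^l, the image of Sym(X) in Sym(Omega) *)
Definition Snl : {group {perm hyperedge}} :=
  (actperm hyperedge_act @* [set: {perm X}])%G.

(* the set of orbits Omega_m / S_n^l *)
Definition unlabelled_hypergraphs (m : nat) : {set {set {set hyperedge}}} :=
  orbit ('P^*)%act Snl @: hypergraphs m.

End Hypergraphs.

(* Main.v *)
(* By Burnside's lemma, n! times the number of orbits is the sum over g in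
   Sym(X) of the number of hypergraphs fixed by g; the identity contributes
   |Omega_m|.
   Let g move s >= 1 points and let N = |Omega|, p = m / N. Then g moves at
   least about s N / n hyperedges, and a third of these form a set B disjoint
   from its image, so there are t >= s N / (6 n) disjoint pairs of hyperedges
   on each of which a fixed hypergraph is constant. For a random hypergraph
   with edge density p this has probability at most
   (p^2 + (1 - p)^2)^t <= exp (- mbar t / N); conditioning on exactly m edges
   costs a factor N + 1, because m is the mode of the binomial distribution.
   Hence g fixes a proportion (N + 1) exp (- mbar s / (6 n)) of the hypergraphs
   at most, which is below n^(-1 - 2 s) as soon as n is large and
   mbar >= n^2 ln n / (2 l). Summing n^(-2 s) over all maps X -> X gives at most
   (1 + 1 / n)^n <= e, so the relative error is at most e / n. *)

Require Import Defs.
From mathcomp Require Import all_boot fingroup morphism perm action zify.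

(** * Sets fixed by a permutation of their ground set *)

(** Take [B] maximal. A moved point outside [B], [s @: B] and [s @^-1: B] could be added to [B], so
    these three sets of equal size cover all moved points. *)
Lemma exists_displaced_set (T : finType) (s : {perm T}) :
  exists2 B : {set T}, [disjoint B & s @: B] &
    #|[set x | s x != x]| <= 3 * #|B|.
Proof.
pose P (B : {set T}) := [disjoint B & s @: B].
have P0 : P set0 by rewrite /P imset0 disjoints_subset sub0set.
case: (maxset_exists P0) => B /maxsetP[PB maxB] _; exists B => //.
have sub : [set x | s x != x] \subset B :|: (s @: B :|: s @^-1: B).
  apply/subsetP => x; rewrite !inE => sx.
  apply: contraR sx; rewrite !negb_or => /and3P[xB xsB sxB].
  apply: contraNT xB => sx.
  rewrite -(maxB (x |: B)) ?setU11 ?subsetUr //.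
  rewrite /P imsetU1 disjoints_subset; apply/subsetP => y.
  rewrite !inE negb_or => /predU1P[->|yB]; first by rewrite eq_sym sx.
  by rewrite (disjointFr PB yB) andbT; apply: contraNneq sxB => <-.
apply: leq_trans (subset_leq_card sub) _.
have cU (C D : {set T}) : #|C :|: D| <= #|C| + #|D| by rewrite cardsU leq_subr.
apply: leq_trans (cU _ _) _; rewrite mulSn leq_add2l.
apply: leq_trans (cU _ _) _.
rewrite card_preimset; last exact: perm_inj.
rewrite card_imset; last exact: perm_inj.
by rewrite mulSn mul1n.
Qed.

(* A set fixed by [s] is determined by its trace outside [s @: B]; charging
   the weight of [s x] to [x \in B], the sum factors over the points. *)
Lemma sum_weight_fixed_le (T : finType) (s : {perm T}) (B : {set T})
    (a b : nat) (F := [set H : {set T} | s @: H == H]) :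
  [disjoint B & s @: B] ->
  \sum_(H in F) a ^ #|H| * b ^ (#|T| - #|H|) <=
    (a ^ 2 + b ^ 2) ^ #|B| * (a + b) ^ (#|T| - 2 * #|B|).
Proof.
move=> dB.
have iB x : x \in B -> x \notin s @: B by move=> xB; rewrite (disjointFr dB xB).
pose w (j : bool) := if j then a else b.
(* On [s @: B] the factor is 1 for [false] and 0 for [true], hence sums to 1; the weight of such a
   point sits in the square at its preimage in [B]. *)
pose W x j :=
  if x \in B then w j ^ 2 else if x \in s @: B then ~~ j : nat else w j.
pose h (H : {set T}) : {ffun T -> bool} :=
  [ffun x => (x \in H) && (x \notin s @: B)].
have sH (H : {set T}) x : H \in F -> (s x \in H) = (x \in H).
  by rewrite inE => /eqP {1}<-; rewrite mem_imset //; apply: perm_inj.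
have h_inj : {in F &, injective h}.
  move=> H K HF KF /ffunP hHK; apply/setP => x.
  have outB y : y \notin s @: B -> (y \in H) = (y \in K).
    by move=> yB; move: (hHK y); rewrite !ffunE yB !andbT.
  have [/imsetP[y yB ->]|/outB//] := boolP (x \in s @: B).
  by rewrite !sH // outB // iB.
have wE H : H \in F -> a ^ #|H| * b ^ (#|T| - #|H|) = \prod_x W x (h H x).
  move=> HF; rewrite -(cardsC H) addKn.
  have -> : a ^ #|H| * b ^ #|~: H| = \prod_x w (x \in H).
    rewrite (bigID (mem H)) /= -prod_nat_const -prod_nat_const.
    congr (_ * _)%N; first by apply: eq_bigr => x ->.
    apply: eq_big => x; first by rewrite inE.
    by rewrite inE => /negbTE ->.
  rewrite (bigID (mem B)) /= [RHS](bigID (mem B)) /=.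
  rewrite [in LHS](bigID (mem (s @: B)) (fun x => x \notin B)) /=.
  have -> : \prod_(x | (x \notin B) && (x \in s @: B)) w (x \in H) =
            \prod_(x in B) w (x \in H).
    rewrite (eq_bigl (mem (s @: B))); last first.
      by move=> x; rewrite andb_idl // => /(disjointFl dB)->.
    rewrite big_imset /=; last by move=> x y _ _; apply: perm_inj.
    by apply: eq_bigr => x _; rewrite sH.
  rewrite [in RHS](bigID (mem (s @: B)) (fun x => x \notin B)) /=.
  rewrite mulnA -big_split /= [X in _ = _ * (X * _)]big1 ?mul1n; last first.
    by move=> x /andP[/negbTE xB xsB]; rewrite /W ffunE xB xsB andbF.
  congr (_ * _)%N; apply: eq_bigr => x.
    by move=> xB; rewrite /W ffunE xB iB // andbT -mulnn.
  by move=> /andP[/negbTE xB xsB]; rewrite /W ffunE xB (negbTE xsB) andbT.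
rewrite (eq_bigr _ wE).
rewrite -(big_imset (fun f : {ffun T -> bool} => \prod_x W x (f x)) h_inj) /=.
apply: (@leq_trans (\sum_(f : {ffun T -> bool}) \prod_x W x (f x))).
  by rewrite [leqRHS](bigID (mem (h @: F))) /= leq_addr.
rewrite -(bigA_distr_bigA W) (bigID (mem B)) /=.
rewrite (bigID (mem (s @: B)) (fun x => x \notin B)) /=.
rewrite [X in _ * (X * _)]big1 ?mul1n; last first.
  by move=> x /andP[/negbTE xB xsB]; rewrite big_bool /W xB xsB.
rewrite leq_eqVlt; apply/orP; left; apply/eqP; congr (_ * _)%N.
  by rewrite -prod_nat_const; apply: eq_bigr => x xB; rewrite big_bool /W xB.
rewrite (eq_bigl (mem (~: (B :|: s @: B)))); last first.
  by move=> x; rewrite !inE negb_or.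
rewrite -[in RHS](cardsC (B :|: s @: B)) cardsU disjoint_setI0 // cards0 subn0.
rewrite card_imset; last exact: perm_inj.
rewrite addnn -mul2n addKn -prod_nat_const; apply: eq_bigr => x.
rewrite !inE negb_or => /andP[/negbTE xB /negbTE xsB].
by rewrite big_bool /W xB xsB.
Qed.

(** Among the [N.+1] terms of the expansion of [((N - m) + m) ^ N], the one of index [m] is largest:
    the ratio of term [i.+1] to term [i] is that of [(N - i) * m] to [i.+1 * (N - m)]. [tS] and [t0]
    state this without division. *)
Lemma binomial_mode (N m : nat) : m <= N ->
  N ^ N <= N.+1 * ('C(N, m) * (m ^ m * (N - m) ^ (N - m))).
Proof.
move=> mN; pose t i := 'C(N, i) * ((N - m) ^ (N - i) * m ^ i).
have tS i : i < N ->
    i.+1 * t i.+1 = (N - i) * m * ('C(N, i) * ((N - m) ^ (N - i.+1) * m ^ i)).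
  by move=> iN; rewrite /t mulnA mul_bin_left expnS; lia.
have t0 i : i < N ->
    i.+1 * t i = i.+1 * (N - m) * ('C(N, i) * ((N - m) ^ (N - i.+1) * m ^ i)).
  by move=> iN; rewrite /t subnS -{1}(@prednK (N - i)) ?subn_gt0 // expnS; lia.
have up d : d <= m -> t (m - d) <= t m.
  elim: d => [|d IH] dm; first by rewrite subn0.
  apply: leq_trans (IH (ltnW dm)).
  have E : m - d = (m - d.+1).+1 by lia.
  rewrite E -(leq_pmul2l (ltn0Sn (m - d.+1))) tS ?t0; try lia.
  by apply: leq_mul => //; rewrite mulnC; apply: leq_mul; lia.
have down d : d <= N - m -> t (m + d) <= t m.
  elim: d => [|d IH] dm; first by rewrite addn0.
  apply: leq_trans (IH (ltnW dm)).
  rewrite addnS -(leq_pmul2l (ltn0Sn (m + d))) tS ?t0; try lia.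
  by apply: leq_mul => //; rewrite [leqRHS]mulnC; apply: leq_mul; lia.
have -> : 'C(N, m) * (m ^ m * (N - m) ^ (N - m)) = t m.
  by rewrite /t [m ^ m * _]mulnC.
rewrite -[X in X ^ N](subnK mN) expnDn.
rewrite -[in leqRHS](card_ord N.+1) -sum_nat_const.
apply: leq_sum => i _; have := ltn_ord i; rewrite ltnS => iN.
rewrite -/(t i); case: (leqP i m) => im.
  by have := up (m - i); rewrite subKn //; apply; rewrite leq_subr.
by have := down (i - m); rewrite subnKC ?(ltnW im) //; apply; rewrite leq_sub2r.
Qed.

(** With [a = m] and [b = N - m], all sets of size [m] have the same weight, so the fixed ones form
    one slice of the sum in [sum_weight_fixed_le]; [binomial_mode] then removes the common
    weight. *)
Lemma card_fixed_draws_le (T : finType) (s : {perm T}) (B : {set T}) (m : nat)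
    (N := #|T|) :
  [disjoint B & s @: B] -> m <= N ->
  #|[set H : {set T} | (#|H| == m) && (s @: H == H)]| * N ^ (2 * #|B|) <=
    N.+1 * 'C(N, m) * (m ^ 2 + (N - m) ^ 2) ^ #|B|.
Proof.
move=> dB mN; set F := [set H | _].
(* This includes [m = 0] and [m = N], since [0 ^ 0 = 1]. *)
have w_gt0 : 0 < m ^ m * (N - m) ^ (N - m).
  by rewrite muln_gt0 !expn_gt0; lia.
have tN : 2 * #|B| <= N.
  have := max_card (mem (B :|: s @: B)); rewrite cardsU disjoint_setI0 //.
  by rewrite cards0 subn0 card_imset ?mul2n ?addnn //; apply: perm_inj.
rewrite -(leq_pmul2r w_gt0).
have FE : #|F| * (m ^ m * (N - m) ^ (N - m)) <=
    (m ^ 2 + (N - m) ^ 2) ^ #|B| * N ^ (N - 2 * #|B|).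
  have := @sum_weight_fixed_le T s B m (N - m) dB; rewrite -/N subnKC //.
  apply: leq_trans; rewrite -sum_nat_const.
  rewrite [leqRHS](bigID (fun H : {set T} => #|H| == m)) /=.
  apply: leq_trans (leq_addr _ _).
  rewrite leq_eqVlt; apply/orP; left; apply/eqP; apply: eq_big => H.
    by rewrite !inE andbC.
  by rewrite inE => /andP[/eqP-> _].
rewrite mulnAC; apply: leq_trans (leq_mul FE (leqnn _)) _.
rewrite -mulnA -expnD subnK // mulnC.
rewrite [leqRHS]mulnAC -[N.+1 * _ * _]mulnA; apply: leq_mul => //.
exact: binomial_mode.
Qed.

(** * Counting the hyperedges moved by a permutation of the vertices *)

(** Count pairs of a moved set and a point in it. If [g x != x], adding [x] to an [l]-set that
    avoids [x] and [g x] gives a moved set: its image contains [g x], the set itself does not. *)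
Lemma card_moved_draws_ge (X : finType) (l : nat) (g : {perm X}) :
  #|[set x | g x != x]| * 'C(#|X| - 2, l) <=
    l.+1 * #|[set A : {set X} | (#|A| == l.+1) && (g @: A != A)]|.
Proof.
set M := [set A : {set X} | _].
have -> : l.+1 * #|M| = \sum_(A in M) \sum_x (x \in A).
  rewrite mulnC -sum_nat_const; apply: eq_bigr => A.
  by rewrite inE => /andP[/eqP<- _]; rewrite -sum1_card big_mkcond.
rewrite exchange_big /= -sum_nat_const.
rewrite [leqRHS](bigID (mem [set x | g x != x])) /=.
apply: leq_trans (leq_addr _ _); apply: leq_sum => x; rewrite inE => gx.
have -> : \sum_(A in M) (x \in A) = #|[set A in M | x \in A]|.
  rewrite -sum1_card [RHS]big_mkcond [LHS]big_mkcond; apply: eq_bigr => A _.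
  by rewrite !inE; case: (x \in A); case: (_ && _).
have cX : #|~: [set x; g x]| = #|X| - 2
  by rewrite -(cardsC [set x; g x]) cards2 eq_sym gx addKn.
rewrite -cX -cards_draws.
have inj : {in [set A : {set X} | A \subset ~: [set x; g x] & #|A| == l] &,
            injective (fun A => x |: A)}.
  move=> A A' /=; rewrite !inE (subsetC A) (subsetC A') !subUset !sub1set.
  move=> /andP[/andP[xA _] _] /andP[/andP[xA' _] _] /(congr1 (fun C => C :\ x)).
  by rewrite !setU1K // -?in_setC.
rewrite -(card_in_imset inj); apply: subset_leq_card.
apply/subsetP => _ /imsetP[A + ->].
rewrite !inE (subsetC A) subUset !sub1set !inE.
move=> /andP[/andP[xA gxA] /eqP cA]; rewrite cardsU1 xA cA add1n !eqxx /= andbT.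
apply: contra gx => /eqP/setP/(_ (g x)).
rewrite mem_imset ?setU11; last exact: perm_inj.
by rewrite !inE (negbTE gxA) orbF => <-.
Qed.

(** * Burnside's lemma and the hypergraphs fixed by one permutation *)

Lemma card_hyperedge (X : finType) (l : nat) :
  #|{: hyperedge X l}| = 'C(#|X|, l).
Proof. by rewrite -card_draws card_sig; apply: eq_card => A; rewrite inE. Qed.

Lemma card_hypergraphs (X : finType) (l m : nat) :
  #|hypergraphs X l m| = 'C('C(#|X|, l), m).
Proof. by rewrite card_draws card_hyperedge. Qed.

Definition hyperedge_perm (X : finType) (l : nat) (g : {perm X}) :
  {perm hyperedge X l} := actperm (hyperedge_act X l) g.

Definition fixed_hypergraphs (X : finType) (l m : nat) (g : {perm X}) :
  {set {set hyperedge X l}} :=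
  [set H : {set hyperedge X l} |
    (#|H| == m) && (hyperedge_perm X l g @: H == H)].

Lemma hyperedge_permE (X : finType) (l : nat) (g : {perm X})
    (A : hyperedge X l) :
  hyperedge_perm X l g A = hyperedge_act X l A g.
Proof. by rewrite /hyperedge_perm actpermE. Qed.

Lemma val_hyperedge_perm (X : finType) (l : nat) (g : {perm X})
    (A : hyperedge X l) :
  val (hyperedge_perm X l g A) = g @: val A.
Proof. by rewrite hyperedge_permE val_hyperedge_act. Qed.

Lemma card_moved_hyperedge (X : finType) (l : nat) (g : {perm X}) :
  #|[set A | hyperedge_perm X l g A != A]| =
  #|[set A : {set X} | (#|A| == l) && (g @: A != A)]|.
Proof.
rewrite -(card_imset _ (@val_inj _ _ (hyperedge X l))); apply: eq_card => A.
rewrite inE; apply/imsetP/andP => [[B + ->]|[cA gA]].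
  by rewrite inE -(inj_eq val_inj) val_hyperedge_perm => ->; rewrite (valP B).
exists (exist _ A cA) => //.
by rewrite inE -(inj_eq val_inj) val_hyperedge_perm.
Qed.

(** Burnside's lemma is applied to [{perm X}] acting through [actperm], not to the image [Snl]: the
    orbits agree, and the group order is [#|X|] factorial even where the action is not faithful. *)
Lemma card_unlabelled_hypergraphs (X : finType) (l m : nat) :
  #|unlabelled_hypergraphs X l m| * #|X|`! =
  \sum_(g : {perm X}) #|fixed_hypergraphs X l m g|.
Proof.
pose to := ('P^* \o actperm (hyperedge_act X l))%act.
have dom g : g \in subact_dom (fun A : {set X} => #|A| == l) ('P^*)%act.
  by rewrite hyperedge_act_dom.
have orbE : orbit ('P^*)%act (Snl X l) =1 orbit to [set: {perm X}].
  move=> H; rewrite /orbit /= morphimE setIT -imset_comp.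
  by apply/setP => K; apply/imsetP/imsetP => -[g _ ->]; exists g => //;
    first [exact: dom | exact: in_setT].
have acts : [acts [set: {perm X}], on hypergraphs X l m | to].
  apply/subsetP => g _; apply/setIP; split.
    by apply/morphpreP; split; [exact: dom | rewrite inE].
  rewrite inE; apply/subsetP => H; rewrite !inE /= => cH.
  by rewrite /comp_act /= /setact card_imset //; apply: perm_inj.
have cS : #|[set: {perm X}]| = #|X|`!.
  rewrite -[in RHS]cardsT -card_perm; apply: eq_card => g.
  by rewrite !inE; apply/esym/subsetP => x _; rewrite inE.
have := Frobenius_Cauchy acts; rewrite cS => E.
rewrite /unlabelled_hypergraphs (eq_imset _ orbE) -{}E.
apply: eq_big => g; first by rewrite inE.
by move=> _; apply: eq_card => H; rewrite !inE sub1set inE.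
Qed.

Lemma bin_le_expn (n k : nat) : 'C(n, k) <= n ^ k.
Proof.
have ffact_le : n ^_ k <= n ^ k.
  elim: k => // k IH; rewrite ffactnSr expnSr; apply: leq_mul => //.
  exact: leq_subr.
apply: leq_trans ffact_le; rewrite -bin_ffact leq_pmulr //; exact: fact_gt0.
Qed.

(** The left side is [n * 'C(n - 1, l)], and at least half of the [l]-subsets of [n - 1] points
    avoid a given point when [2 * l <= n - 1]. *)
Lemma bin_le_bin_sub2 (n l : nat) :
  2 * l.+1 <= n -> l.+1 * 'C(n, l.+1) <= 2 * n * 'C(n - 2, l).
Proof.
case: n => [|[|n]]; rewrite ?subn2 /=; try lia; move=> ln.
rewrite -mul_bin_diag -[2 * _]mulnC -mulnA leq_pmul2l //.
have nl : 0 < n.+1 - l by lia.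
rewrite -(leq_pmul2l nl) -mul_bin_down /= mulnA; apply: leq_mul => //; lia.
Qed.

(** The 6 is the 3 of [exists_displaced_set] times the 2 of [bin_le_bin_sub2]; [t] is the size of
    the displaced set of hyperedges. *)
Lemma card_fixed_hypergraphs_le (X : finType) (l m : nat) (g : {perm X})
    (N := 'C(#|X|, l.+1)) :
  2 * l.+1 <= #|X| -> m <= N ->
  exists2 t, #|[set x | g x != x]| * N <= 6 * #|X| * t &
    #|fixed_hypergraphs X l.+1 m g| * N ^ (2 * t) <=
      N.+1 * 'C(N, m) * (m ^ 2 + (N - m) ^ 2) ^ t.
Proof.
move=> lX mN; pose s := hyperedge_perm X l.+1 g.
have [B dB hB] := exists_displaced_set _ s.
exists #|B|; last first.
  by have := card_fixed_draws_le _ s _ m dB; rewrite card_hyperedge; apply.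
have h1 := card_moved_draws_ge X l g; rewrite -card_moved_hyperedge in h1.
have h2 := bin_le_bin_sub2 _ _ lX.
rewrite -(leq_pmul2l (ltn0Sn l)) mulnCA.
apply: leq_trans (leq_mul (leqnn _) h2) _; rewrite mulnCA.
apply: leq_trans (leq_mul (leqnn _) (leq_trans h1 (leq_mul (leqnn _) hB))) _.
by rewrite leq_eqVlt; apply/orP; left; apply/eqP; lia.
Qed.

From mathcomp Require Import all_boot all_order all_algebra all_fingroup.
From mathcomp Require Import all_classical all_reals all_analysis.
From mathcomp Require Import lra.
Import Order.TTheory GRing.Theory Num.Theory.
Import numFieldNormedType.Exports.
Local Open Scope classical_set_scope.
Local Open Scope ring_scope.

(** * Exponential bounds and the Burnside sum *)

Definition support_size (X : finType) (g : {perm X}) : nat :=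
  #|[set x | g x != x]%SET|.

(** Over all maps the sum factors: each point contributes 1 for staying and [u] for each other
    image. *)
Lemma sum_expr_support_size_le (R : realType) (X : finType) (u : R) : 0 <= u ->
  \sum_(g : {perm X}) u ^+ support_size X g <= (1 + #|X|%:R * u) ^+ #|X|.
Proof.
move=> u0; pose W (x y : X) : R := if y == x then 1 else u.
have W0 x y : 0 <= W x y by rewrite /W; case: ifP.
pose h (g : {perm X}) : {ffun X -> X} := [ffun x => g x].
have h_inj : {in predT &, injective h}.
  by move=> g g' _ _ /ffunP E; apply/permP => x; have := E x; rewrite !ffunE.
have wE (g : {perm X}) : true -> u ^+ support_size X g = \prod_x W x (h g x).
  move=> _; rewrite [RHS](bigID (mem [set x | g x != x]%SET)) /=.
  rewrite [X in _ * X]big1 ?mulr1.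
    rewrite -prodr_const; apply: eq_bigr => x; rewrite inE /W ffunE.
    by move=> /negbTE->.
  by move=> x; rewrite inE negbK /W ffunE => ->.
rewrite (eq_bigr _ wE).
rewrite -(big_imset (fun f : {ffun X -> X} => \prod_x W x (f x)) h_inj) /=.
apply: (@le_trans _ _ (\sum_(f : {ffun X -> X}) \prod_x W x (f x))).
  rewrite [leRHS](bigID (mem (h @: predT)%SET)) /= lerDl.
  by apply: sumr_ge0 => f _; apply: prodr_ge0.
rewrite -(bigA_distr_bigA W) /= -[leRHS]prodr_const.
apply: ler_prod => x _; rewrite sumr_ge0 //= (bigD1 x) //= /W eqxx lerD2l.
apply: (@le_trans _ _ (\sum_(y in X) u)); last by rewrite sumr_const mulr_natl.
rewrite [leLHS]big_mkcond /=; apply: ler_sum => y _.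
by case: ifPn => // yx; rewrite (negbTE yx).
Qed.

Lemma card_fixed_hypergraphs_le_expR (R : realType) (X : finType) (l m : nat)
    (g : {perm X}) (N := 'C(#|X|, l.+1)) :
  (2 * l.+1 <= #|X|)%N -> (m <= N)%N ->
  #|fixed_hypergraphs X l.+1 m g|%:R <= N.+1%:R * 'C(N, m)%:R *
    expR (- ((minn m (N - m))%:R * (support_size X g)%:R / (6 * #|X|%:R))) :> R.
Proof.
move=> lX mN; have [t ht hF] := card_fixed_hypergraphs_le X l m g lX mN.
have X0 : (0 < #|X|)%N by apply: leq_trans lX.
have N0 : (0 < N)%N by rewrite bin_gt0; apply: leq_trans lX; rewrite leq_pmull.
have N0R : 0 < N%:R :> R by rewrite ltr0n.
pose b := minn m (N - m).
set q : R := (m%:R ^+ 2 + (N - m)%:R ^+ 2) / N%:R ^+ 2.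
have q0 : 0 <= q by rewrite divr_ge0 ?addr_ge0 ?exprn_ge0.
(* With [p = m / N], [q = 1 - 2 p (1 - p)]; the larger of [p] and [1 - p] is at least 1/2, so
   [q <= 1 - b / N]. *)
have hq : q <= expR (- (b%:R / N%:R)).
  apply: le_trans (expR_ge1Dx _).
  rewrite /q ler_pdivrMr ?exprn_gt0 //.
  have -> : (1 + - (b%:R / N%:R)) * N%:R ^+ 2 = N%:R ^+ 2 - b%:R * N%:R :> R.
    by rewrite mulrDl mul1r mulNr expr2 mulrA divfK ?gt_eqF.
  rewrite natrB // /b; case: (leqP m (N - m)) => hm.
    have hm' : (m%:R : R) <= N%:R - m%:R by rewrite -natrB // ler_nat.
    have : 0 <= m%:R :> R by [].
    by nra.
  have hm' : N%:R - m%:R <= (m%:R : R) by rewrite -natrB // ler_nat ltnW.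
  have : (m%:R : R) <= N%:R by rewrite ler_nat.
  by rewrite natrB //; nra.
have hF' : #|fixed_hypergraphs X l.+1 m g|%:R <=
    N.+1%:R * 'C(N, m)%:R * q ^+ t :> R.
  rewrite /q expr_div_n mulrA -exprM ler_pdivlMr ?exprn_gt0 //.
  by rewrite -!natrX -natrD -natrX -!natrM ler_nat.
apply: le_trans hF' _; apply: ler_wpM2l; first by rewrite mulr_ge0.
apply: (@le_trans _ _ (expR (- (b%:R / N%:R)) ^+ t)).
  by rewrite lerXn2r // nnegrE ?expR_ge0.
rewrite -expRM_natr ler_expR mulNr lerN2 -!mulrA ler_wpM2l //.
rewrite ler_pdivrMr ?mulr_gt0 ?ltr0n // mulrC mulrA.
rewrite -mulrA [X in _ <= X]mulrC -mulrA -ler_pdivrMl ?invr_gt0 // invrK mulrC.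
have := ht; rewrite -(ler_nat R) !natrM /support_size; lra.
Qed.

Lemma support_size_gt0 (X : finType) (g : {perm X}) :
  g != 1%g -> (0 < support_size X g)%N.
Proof.
apply: contraNltn; rewrite leqn0 cards_eq0 => /eqP g0.
apply/eqP/permP => x; rewrite perm1; apply/eqP.
by move/setP: g0 => /(_ x); rewrite !inE => /negbFE.
Qed.

(** The threshold on [n] makes the exponential at most [n ^ (- (l + 5) s)], where [s] is the support
    size. Since [s >= 1], [(l + 5) s >= (l + 2) + 1 + 2 s]: the first [l + 2] powers absorb
    [N.+1 <= n ^ (l + 2)], the others form the bound. *)
Lemma card_fixed_hypergraphs_le_expn (R : realType) (X : finType) (l m : nat)
    (g : {perm X}) (n := #|X|) (N := 'C(n, l.+1)) :
  (12 * l.+1 * (l + 5) <= n)%N -> (m <= N)%N ->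
  n%:R ^+ 2 * ln n%:R / (2 * l.+1%:R) <= (minn m (N - m))%:R :> R ->
  g != 1%g ->
  #|fixed_hypergraphs X l.+1 m g|%:R <=
    'C(N, m)%:R * (n%:R^-1 * (n%:R ^- 2) ^+ support_size X g) :> R.
Proof.
move=> hn mN hm g1; have s0 := support_size_gt0 X g g1.
set s := support_size X g in s0 *.
have n1 : (1 < n)%N by nia.
have n0 : 0 < n%:R :> R by rewrite ltr0n ltnW.
have v0 : 0 < n%:R^-1 :> R by rewrite invr_gt0.
have v1 : n%:R^-1 <= 1 :> R by rewrite invf_le1 // ler1n ltnW.
have lX : (2 * l.+1 <= #|X|)%N by rewrite -/n; nia.
apply: le_trans (card_fixed_hypergraphs_le_expR R X l m g lX mN) _.
rewrite -/n -/N -/s -[_ * _ * expR _]mulrA mulrCA; apply: ler_wpM2l => //.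
have hN : N.+1%:R <= n%:R ^+ l.+2 :> R.
  rewrite -natrX ler_nat (@leq_trans ((n ^ l.+1).+1)) ?ltnS ?bin_le_expn //.
  by rewrite [leqRHS]expnS -[ltnLHS]mul1n ltn_pmul2r // expn_gt0 ltnW.
have lnn : 0 <= ln (n%:R : R) by rewrite ln_ge0 // ler1n ltnW.
have he : expR (- ((minn m (N - m))%:R * s%:R / (6 * n%:R))) <=
    (n%:R^-1) ^+ ((l + 5) * s) :> R.
  rewrite -[X in _ <= X ^+ _]lnK ?posrE // lnV ?posrE // -expRM_natr ler_expR.
  rewrite mulNr lerN2 ler_pdivlMr ?mulr_gt0 //.
  rewrite natrM [ln _ * _]mulrA [leLHS]mulrAC; apply: ler_wpM2r => //.
  apply: le_trans hm; rewrite ler_pdivlMr ?mulr_gt0 //.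
  have hln : 12 * l.+1%:R * (l + 5)%:R <= n%:R :> R by rewrite -!natrM ler_nat.
  have -> : ln n%:R * (l + 5)%:R * (6 * n%:R) * (2 * l.+1%:R) =
     (12 * l.+1%:R * (l + 5)%:R) * (n%:R * ln n%:R) :> R by lra.
  by rewrite expr2 -[leRHS]mulrA; apply: ler_wpM2r => //; rewrite mulr_ge0.
apply: (@le_trans _ _ (n%:R ^+ l.+2 * (n%:R^-1) ^+ (l.+2 + (1 + 2 * s)))).
  apply: ler_pM => //; rewrite ?expR_ge0 //; apply: le_trans he _.
  by apply: ler_wiXn2l => //; nia.
rewrite exprD mulrA -exprMn divff ?gt_eqF // expr1n mul1r.
by rewrite exprD expr1 exprM exprVn.
Qed.

Lemma card_unlabelled_hypergraphs_bounds (R : realType) (X : finType)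
    (l m : nat) (n := #|X|) (N := 'C(n, l.+1)) :
  (12 * l.+1 * (l + 5) <= n)%N -> (m <= N)%N ->
  n%:R ^+ 2 * ln n%:R / (2 * l.+1%:R) <= (minn m (N - m))%:R :> R ->
  0 <= (#|unlabelled_hypergraphs X l.+1 m|%:R * n`!%:R /
          #|hypergraphs X l.+1 m|%:R - 1 : R) <= expR 1 / n%:R.
Proof.
move=> hn mN hm.
have n0 : 0 < n%:R :> R by rewrite ltr0n; nia.
have v0 : 0 <= n%:R ^- 2 :> R by rewrite invr_ge0 exprn_ge0.
have C0 : 0 < 'C(N, m)%:R :> R by rewrite ltr0n bin_gt0.
rewrite card_hypergraphs -natrM card_unlabelled_hypergraphs -/n -/N.
rewrite (bigD1 (1%g : {perm X})) //= natrD.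
have -> : #|fixed_hypergraphs X l.+1 m 1%g| = 'C(N, m).
  rewrite -card_hypergraphs; apply: eq_card => H; rewrite !inE.
  by rewrite /hyperedge_perm morph1 (eq_imset _ (@perm1 _)) imset_id eqxx andbT.
rewrite mulrDl divff ?gt_eqF // addrC addKr divr_ge0 //=.
rewrite ler_pdivrMr // natr_sum.
(* A nonnegative term for the identity is put back, so that the sum over all of [{perm X}] can be
   bounded. *)
apply: (@le_trans _ _ (\sum_(g : {perm X}) 'C(N, m)%:R *
    (n%:R^-1 * (n%:R ^- 2) ^+ support_size X g))).
  rewrite [leRHS](bigD1 (1%g : {perm X})) //= -[leLHS]add0r; apply: lerD.
    by rewrite !mulr_ge0 ?invr_ge0 ?exprn_ge0.
  by apply: ler_sum => g g1; apply: card_fixed_hypergraphs_le_expn.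
rewrite -mulr_sumr mulrC; apply: ler_wpM2r => //.
rewrite -mulr_sumr mulrC; apply: ler_wpM2r; first by rewrite invr_ge0.
apply: le_trans (sum_expr_support_size_le R X _ v0) _; rewrite -/n.
have -> : n%:R * n%:R ^- 2 = n%:R^-1 :> R.
  by rewrite expr2 invfM mulrA divff ?mul1r ?gt_eqF.
have -> : expR 1 = expR (n%:R^-1) ^+ n :> R.
  by rewrite -expRM_natr mulVf ?gt_eqF.
by rewrite lerXn2r // ?nnegrE ?expR_ge0 ?addr_ge0 ?invr_ge0 // expR_ge1Dx.
Qed.

(** * Passage to the limit *)

(** The lower limit is the supremum of the tail infima, so some tail infimum already exceeds [c]. *)
Lemma limn_einf_gt_near (R : realType) (u : nat -> \bar R) (c : \bar R) :
  (c < limn_einf u)%E -> \forall k \near \oo, (c < u k)%E.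
Proof.
rewrite limn_einf_lim (cvg_lim _ (@cvg_einfs_sup R u)) //.
move=> /ereal_sup_gt[_ [j _ <-] cj]; exists j => // k /= jk.
by apply: lt_le_trans cj _; apply: ereal_inf_lbound; exists k.
Qed.

Theorem mainTheorem4 (R : realType) (l : nat) (l_ge3 : (3 <= l)%N)
    (n m : nat -> nat) (X : nat -> finType)
    (card_X : forall k, #|X k| = n k)
    (mbar : nat -> nat)
    (mbarE : forall k,
      mbar k = minn (m k) (#|{: hyperedge (X k) l}| - m k)%N)
    (mbar_oo : mbar @ \oo --> \oo)
    (n_oo : n @ \oo --> \oo)
    (liminf_gt :
      ((1 / (2 * l%:R))%:E <
       limn_einf (fun k => ((mbar k)%:R / ((n k)%:R ^+ 2 * ln (n k)%:R))%:E
                           : \bar R))%E) :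
  exists2 eps : nat -> R,
    eps @ \oo --> 0 &
    \forall k \near \oo,
      #|unlabelled_hypergraphs (X k) l (m k)|%:R =
        #|hypergraphs (X k) l (m k)|%:R / (n k)`!%:R * (1 + eps k).
Proof.
case: l l_ge3 mbarE liminf_gt => // l _ mbarE liminf_gt.
pose eps k : R := #|unlabelled_hypergraphs (X k) l.+1 (m k)|%:R * (n k)`!%:R /
                  #|hypergraphs (X k) l.+1 (m k)|%:R - 1.
have hn K : \forall k \near \oo, (K <= n k)%N by move: K; apply/cvgnyPge.
(* Truncated subtraction gives [mbar k = 0] when [m k] exceeds the number of hyperedges;
   [mbar k >= 1] rules this out. *)
have hm : \forall k \near \oo, (m k <= 'C(n k, l.+1))%N.
  have /cvgnyPge := mbar_oo; move=> /(_ 1%N); apply: filterS => k.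
  by rewrite mbarE card_hyperedge card_X; lia.
exists eps; last first.
  (* This is the definition of [eps] solved for the orbit count; [mN] keeps the denominator
     nonzero. *)
  apply: filterS hm => k mN; rewrite /eps [1 + _]addrC subrK.
  rewrite card_hypergraphs card_X.
  have f0 : (n k)`!%:R != 0 :> R by rewrite pnatr_eq0 -lt0n fact_gt0.
  have c0 : 'C('C(n k, l.+1), m k)%:R != 0 :> R.
    by rewrite pnatr_eq0 -lt0n bin_gt0.
  by rewrite [RHS]mulrC mulrA divfK // mulfK.
have nV : (expR 1 / (n k)%:R : R) @[k --> \oo] --> (0 : R).
  have nV0 : ((n k)%:R^-1 : R) @[k --> \oo] --> (0 : R).
    apply/gtr0_cvgV0; last exact/cvgrnyP.
    by apply: filterS (hn 1%N) => k; rewrite ltr0n.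
  by have := cvgM (cvg_cst (expR 1 : R)) nV0; rewrite mulr0; apply.
(* The relative error is squeezed between 0 and [expR 1 / n k]. *)
apply: (@squeeze_cvgr _ _ _ _ (cst 0) _ _ _ _ (cvg_cst _) nV).
near=> k.
have hk : (12 * l.+1 * (l + 5) <= n k)%N by near: k; exact: hn.
have mk : (m k <= 'C(n k, l.+1))%N by near: k.
have uk : ((1 / (2 * l.+1%:R))%:E <
    ((mbar k)%:R / ((n k)%:R ^+ 2 * ln (n k)%:R) : R)%:E)%E.
  by near: k; exact: limn_einf_gt_near liminf_gt.
have n1 : 1 < (n k)%:R :> R by rewrite ltr1n; nia.
have L0 : 0 < (n k)%:R ^+ 2 * ln (n k)%:R :> R.
  by rewrite mulr_gt0 ?ln_gt0 // exprn_gt0 // (lt_trans _ n1).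
move: uk; rewrite lte_fin ltr_pdivlMr // mul1r => uk.
rewrite /eps -card_X.
apply: card_unlabelled_hypergraphs_bounds; rewrite card_X //.
by rewrite mulrC ltW // -(card_X k) -card_hyperedge -mbarE card_X.
Unshelve. all: by end_near.
Qed.
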